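(* Let $P$ be a probability assignment on $L$. There exists a stochastic valuation $\check P$, unique up to equality of finite-dimensional distributions, such that $\mathrm{Prob}(\check P_A=U)=P(\phi_A^U)$ for every non-empty finite $A\subseteq B$ and every $U\subseteq A$.
   Context: $B=\{B_j: j\in\mathbb N\}$ is a denumerable set of propositional symbols and $L$ is the set of propositional formulas generated from $B$ by $\neg$ and $\supset$ (other connectives are the usual abbreviations). $\vDash_c$ denotes classical propositional entailment. A probability assignment is a map $P$ from $L$ to the reals such that for all $\alpha,\beta\in L$: (P1) $0\le P(\alpha)\le1$; (P2) if $\vDash_c\alpha$ then $P(\alpha)=1$; (P3) if $\alpha\vDash_c\beta$ then $P(\alpha)\le P(\beta)$; (P4) if $\vDash_c\neg(\beta\wedge\alpha)$ then $P(\beta\vee\alpha)=P(\beta)+P(\alpha)$. For $U\subseteq A\subseteq B$ with $A$ finite, $\phi_A^U$ is the formula $\big(\bigwedge_{B_j\in U}B_j\big)\wedge\big(\bigwedge_{B_j\in A\setminus U}\neg B_j\big)$. A stochastic valuation $V$ is a family $\{V_{B_j}\}_{B_j\in B}$ of random variables on a probability space $(\Omega,\mathcal F,\mu)$, where $V_{B_j}$ takes values in $\{\emptyset,\{B_j\}\}$ ($\emptyset$ for false, $\{B_j\}$ for true). For finite non-empty $A\subseteq B$ and $U\subseteq A$, $\mathrm{Prob}(V_A=U)=\mu\big(\bigcap_{B_j\in A}V_{B_j}^{-1}(U\cap\{B_j\})\big)$; the maps $U\mapsto\mathrm{Prob}(V_A=U)$ are the finite-dimensional distributions of $V$. Two stochastic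 valuations are identified (equivalent) when they have the same finite-dimensional distributions. *)

(* Defs.v *)
From HB Require Import structures.
From mathcomp Require Import all_boot all_order all_algebra finmap.
From mathcomp Require Import all_classical all_reals all_analysis.
Set Implicit Arguments.
Unset Strict Implicit.
Unset Printing Implicit Defensive.
Import Order.TTheory GRing.Theory Num.Theory.
Local Open Scope classical_set_scope.
Local Open Scope ring_scope.

(* The propositional symbol B_j is identified with its index j, so finite sets
   of symbols are finite sets of natural numbers. *)
Inductive pform : Type :=
| Var of nat
| Neg of pform
| Imp of pform & pform.

Definition Or (a b : pform) : pform := Imp (Neg a) b.
Definition And (a b : pform) : pform := Neg (Imp a (Neg b)).
Definition Top : pform := Imp (Var 0) (Var 0).

Fixpoint eval (v : nat -> bool) (a : pform) : bool :=
  match a with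
  | Var j => v j
  | Neg a => ~~ eval v a
  | Imp a b => eval v a ==> eval v b
  end.

Definition entails (G : set pform) (a : pform) : Prop :=
  forall v : nat -> bool, (forall g, G g -> eval v g) -> eval v a.

Record prob_assignment (R : realType) (P : pform -> R) : Prop :=
  ProbAssignment {
    pa_range : forall a, 0 <= P a <= 1;
    pa_valid : forall a, entails set0 a -> P a = 1;
    pa_mono : forall a b, entails [set a] b -> P a <= P b;
    pa_add : forall a b, entails set0 (Neg (And b a)) ->
      P (Or b a) = P b + P a
  }.

(* The empty conjunction is Top. *)
Definition phi (A U : {fset nat}) : pform :=
  And (\big[And/Top]_(j <- U) Var j)
      (\big[And/Top]_(j <- (A `\` U)%fset) Neg (Var j)).

(* The two-element range {set0, {B_j}} of the j-th random variable is encoded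
   by bool: false stands for set0 and true for {B_j}. *)
Record stoch_valuation (R : realType) : Type := StochValuation {
  sv_disp : measure_display;
  sv_space : measurableType sv_disp;
  sv_prob : probability sv_space R;
  sv_var :> forall j : nat, {RV sv_prob >-> bool}
}.

(* Under this encoding the value (U :&: {B_j}) is the boolean (j \in U). *)
Definition Prob (R : realType) (V : stoch_valuation R) (A U : {fset nat}) :
    \bar R :=
  sv_prob V (\bigcap_(j in [set` A]) (V j @^-1` [set (j \in U)])).

Definition same_fdd (R : realType) (V W : stoch_valuation R) : Prop :=
  forall A U : {fset nat}, A != fset0 -> (U `<=` A)%fset ->
    Prob V A U = Prob W A U.

(* Main.v *)
(* The random variables live on [0, 1[ with Lebesgue measure. Each finite list
   [s] of truth values gets a half-open interval of length P(cyl s), and the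
   interval of [s] is cut into those of its two one-symbol extensions, whose
   lengths add up by (P4). The j-th variable tells on which side of the j-th cut
   a point lies. Cutting down to prefixes long enough to decide a formula [a]
   shows that the points satisfying [a] have measure P(a); taking a = phi_A^U
   gives the theorem. This bypasses Kolmogorov's extension theorem. *)
Require Import Defs.
From HB Require Import structures.
From mathcomp Require Import all_boot all_order all_algebra finmap.
From mathcomp Require Import all_classical all_reals all_analysis.
From mathcomp Require Import lra.
Set Implicit Arguments.
Unset Strict Implicit.
Unset Printing Implicit Defensive.
Import Order.TTheory GRing.Theory Num.Theory.
Local Open Scope classical_set_scope.
Local Open Scope ring_scope.

(* mathcomp-analysis has an [eval] of its own, which shadows that of [Defs]. *)
Local Notation eval := Defs.eval.

Implicit Types (v w : nat -> bool) (a : pform) (s : seq bool).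

(** * Truth of formulas under a valuation *)

Lemma eval_And v a b : eval v (And a b) = eval v a && eval v b.
Proof. by rewrite /=; case: (eval v a); case: (eval v b). Qed.

Lemma eval_bigAnd v (r : seq nat) (F : nat -> pform) :
  eval v (\big[And/Top]_(j <- r) F j) = all (fun j => eval v (F j)) r.
Proof.
elim: r => [|j r IH]; first by rewrite big_nil /= implybb.
by rewrite big_cons eval_And IH.
Qed.

Lemma eval_phi v (A U : {fset nat}) : (U `<=` A)%fset ->
  reflect (forall j, j \in A -> v j = (j \in U)) (eval v (phi A U)).
Proof.
move=> /fsubsetP UA; rewrite /phi eval_And !eval_bigAnd.
apply: (iffP andP) => [[/allP vU /allP vA] j jA|vA]; last first.
  split; apply/allP => j /=; first by move=> jU; rewrite vA // UA.
  by rewrite inE => /andP[jU /vA ->].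
have [/vU //|jU] := boolP (j \in U).
by apply/negbTE/(vA j); rewrite inE jU.
Qed.

(** Supplies the length of prefix that is enough to decide [a]. *)
Lemma eval_finitely_determined a : exists n : nat, forall v w,
  (forall j, (j < n)%N -> v j = w j) -> eval v a = eval w a.
Proof.
elim: a => [i|a [n IH]|a [n IHa] b [m IHb]] /=.
- by exists i.+1 => v w; apply.
- by exists n => v w /IH ->.
- exists (maxn n m) => v w vw; rewrite (IHa v w) ?(IHb v w) // => j jn;
    by apply: vw; rewrite leq_max jn ?orbT.
Qed.

(** * Consequences of (P1)-(P4) *)

Section prob_assignment_theory.
Context (R : realType) (P : pform -> R) (hP : prob_assignment P).

Lemma pa_eq a b : (forall v, eval v a = eval v b) -> P a = P b.
Proof.
move=> ab; apply/eqP; rewrite eq_le.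
by apply/andP; split; apply: (pa_mono hP) => v /(_ _ erefl); rewrite ab.
Qed.

(** An unsatisfiable [a] is incompatible with itself, so (P4) gives [P a = P a + P a]. *)
Lemma pa_unsat a : (forall v, ~~ eval v a) -> P a = 0.
Proof.
move=> a0; have := @pa_add _ _ hP a a.
rewrite (@pa_eq (Or a a) a); last by move=> v; rewrite /=; case: (eval v a).
move=> paa; apply: (@addrI _ (P a)); rewrite addr0 -paa // => v _.
by rewrite /= (negbTE (a0 v)).
Qed.

Lemma pa_split a b : P a = P (And a (Neg b)) + P (And a b).
Proof.
rewrite -(pa_add hP); last first.
  by move=> v _ /=; case: (eval v a); case: (eval v b).
by apply: pa_eq => v /=; case: (eval v a); case: (eval v b).
Qed.

Lemma pa_ge0 a : 0 <= P a.
Proof. by case/andP: (pa_range hP a). Qed.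

End prob_assignment_theory.

(** * Cylinder formulas and the digits of a point *)

(* Truth values are listed with the most recent symbol first: the head of [s]
   is the value of the symbol of index [(size s).-1]. *)
Fixpoint cyl (s : seq bool) : pform :=
  if s is b :: s' then
    And (cyl s') (if b then Var (size s') else Neg (Var (size s')))
  else Top.

Lemma eval_cyl_inj v w s j : eval v (cyl s) -> eval w (cyl s) ->
  (j < size s)%N -> v j = w j.
Proof.
elim: s => [//|b s IH]; rewrite [cyl _]/= !eval_And.
move=> /andP[vs vb] /andP[ws wb]; rewrite ltnS leq_eqVlt => /predU1P[->|].
  by case: b vb wb => /= [-> -> //|/negbTE -> /negbTE ->].
exact: IH.
Qed.

(** Total [P]-mass of the cylinders of the same length that precede [s] lexicographically, oldest
    symbol first and [false] before [true]. *)
Fixpoint left_end (R : realType) (P : pform -> R) (s : seq bool) : R :=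
  if s is b :: s' then
    left_end P s' + (if b then P (cyl (false :: s')) else 0)
  else 0.

(** [left_end P (true :: s)] is the point where the interval of [s] is cut. For a fair coin this is
    the binary expansion of a point of [0, 1[. *)
Fixpoint digits (R : realType) (P : pform -> R) (x : R) (n : nat) : seq bool :=
  if n is m.+1 then
    let s := digits P x m in (left_end P (true :: s) <= x) :: s
  else [::].

Definition bit (R : realType) (P : pform -> R) (j : nat)
    (x : measurableTypeR R) : bool :=
  left_end P (true :: digits P x j) <= x.

Lemma size_digits (R : realType) (P : pform -> R) (x : R) (n : nat) :
  size (digits P x n) = n.
Proof. by elim: n => //= n ->. Qed.

Lemma eval_cyl_digits (R : realType) (P : pform -> R) (x : R) (n : nat) :
  eval (bit P ^~ x) (cyl (digits P x n)).
Proof.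
elim: n => [|n IH]; first by rewrite /= implybb.
rewrite [digits _ _ _]/= -/(bit P n x) [cyl _]/= eval_And.
by rewrite IH size_digits; case: ifP => /= [//|->].
Qed.

Lemma digits_cons (R : realType) (P : pform -> R) (x : R) (b : bool) s :
  (digits P x (size s).+1 == b :: s) =
  (digits P x (size s) == s) && ((left_end P (true :: s) <= x) == b).
Proof.
rewrite [digits _ _ _.+1]/= eqseq_cons andbC.
by case: eqP => //= ->.
Qed.

(** * The interval attached to a list of truth values *)

Section digits_measure.
Context (R : realType) (P : pform -> R) (hP : prob_assignment P).

Let left_end_cons (b : bool) s : left_end P (b :: s) =
  left_end P s + (if b then P (cyl (false :: s)) else 0).
Proof. by []. Qed.

Let cyl_split s : P (cyl s) = P (cyl (false :: s)) + P (cyl (true :: s)).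
Proof. exact: pa_split. Qed.

(** By induction on [s]: each new digit keeps the part of the interval on one side of the cut. The
    intervals being half-open, one of length zero is empty and its list never occurs. *)
Lemma digits_itv x s : 0 <= x < 1 ->
  (digits P x (size s) == s) = (left_end P s <= x < left_end P s + P (cyl s)).
Proof.
move=> x01; elim: s => [|b s IH].
  by rewrite /= add0r (pa_valid hP) ?x01 // => v _ /=; rewrite implybb.
rewrite digits_cons IH cyl_split.
have := pa_ge0 hP (cyl (false :: s)); have := pa_ge0 hP (cyl (true :: s)).
by case: b; rewrite !left_end_cons;
  move: (P (cyl (false :: s))) (P (cyl (true :: s))) (left_end P s) => p0 p1 l;
  move=> ? ?; rewrite ?eqb_id ?eqbF_neg -?ltNge;
  apply/idP/idP=> [/andP[/andP[? ?] ?]|/andP[? ?]];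
  do ?[apply/andP; split]; lra.
Qed.

Lemma left_end_bound s : 0 <= left_end P s /\ left_end P s + P (cyl s) <= 1.
Proof.
elim: s => [|b s].
  by split; rewrite //= add0r; case/andP: (pa_range hP Top).
rewrite cyl_split.
have := pa_ge0 hP (cyl (false :: s)); have := pa_ge0 hP (cyl (true :: s)).
by case: b; rewrite left_end_cons;
  move: (P (cyl (false :: s))) (P (cyl (true :: s))) (left_end P s) => p0 p1 l;
  move=> ? ? [? ?]; split; lra.
Qed.

End digits_measure.

(** * The uniform probability on [0, 1[, carried by the whole line *)

Definition unit_lebesgue (R : realType) : set (measurableTypeR R) -> \bar R :=
  mrestr (@lebesgue_measure R) (measurable_itv `[0, 1[).

HB.instance Definition _ (R : realType) :=
  Measure.copy (@unit_lebesgue R)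
    (mrestr (@lebesgue_measure R) (measurable_itv `[0, 1[)).

Lemma unit_lebesgue_setT (R : realType) : @unit_lebesgue R setT = 1%E.
Proof.
by rewrite /unit_lebesgue /mrestr setTI lebesgue_measure_itv /= lte_fin ltr01
  oppr0 adde0.
Qed.

HB.instance Definition _ (R : realType) :=
  Measure_isProbability.Build _ _ _ (@unit_lebesgue R) (@unit_lebesgue_setT R).

(** * Measurability and joint law of the digits *)

Section bit_law.
Context (R : realType) (P : pform -> R).
Let mu : probability (measurableTypeR R) R := @unit_lebesgue R.

Let prefix s : set (measurableTypeR R) := [set x | digits P x (size s) = s].

Let prefix_cons (b : bool) s : prefix (b :: s) =
  prefix s `&` [set x | (left_end P (true :: s) <= x) = b].
Proof.
apply/seteqP; split=> x; rewrite /prefix /mkset.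
  by move=> /eqP; rewrite digits_cons => /andP[/eqP ? /eqP].
by move=> [/eqP ds /eqP lb]; apply/eqP; rewrite digits_cons ds.
Qed.

Let measurable_prefix s : measurable (prefix s).
Proof.
elim: s => [|b s IH].
  by rewrite (_ : prefix _ = setT) //; apply/seteqP; split.
rewrite prefix_cons; apply: measurableI => //.
have mi : measurable (`[left_end P (true :: s), +oo[ : set (measurableTypeR R)).
  exact: measurable_itv.
case: b; [move: mi | move/measurableC: mi]; congr measurable;
  apply/seteqP; split=> x /=; rewrite in_itv /= andbT //.
  by move/negP/negbTE.
by move=> ->.
Qed.

Lemma measurable_bit j :
  measurable_fun [set: measurableTypeR R] (bit P j).
Proof.
apply: (measurable_fun_bool true); rewrite setTI.
rewrite (_ : _ @^-1` _ = \bigcup_(s in [set s | size s = j]) prefix (true :: s)).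
  (* Lists of the wrong length contribute the empty set, so the union runs over the countable type
     of all lists. *)
  rewrite bigcup_mkcond; apply: countable_bigcupT_measurable => [|s].
    exact: countableP.
  by case: ifP.
apply/seteqP; split=> x /=.
  move=> bx; exists (digits P x j); rewrite /= ?size_digits //.
  by rewrite /prefix /= size_digits -/(bit P j x) bx.
by move=> [s <-] [] + ps; rewrite ps /bit ps => ->.
Qed.

Lemma measurable_eval_bit a :
  measurable ([set x | eval (bit P ^~ x) a] : set (measurableTypeR R)).
Proof.
elim: a => [j|a IH|a IHa b IHb].
- rewrite (_ : mkset _ = setT `&` bit P j @^-1` [set true]).
    exact: measurable_bit.
  by rewrite setTI.
- rewrite (_ : mkset _ = ~` [set x | eval (bit P ^~ x) a]).
    exact: measurableC.
  by apply/seteqP; split=> x /= /negP.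
- rewrite (_ : mkset _ =
    ~` [set x | eval (bit P ^~ x) a] `|` [set x | eval (bit P ^~ x) b]).
    by apply: measurableU => //; exact: measurableC.
  apply/seteqP; split=> x /=.
    by move/implyP; case: (eval _ a) => [/(_ isT)|]; [right|left].
  by move=> [/negP/negbTE -> //|->]; rewrite implybT.
Qed.

Hypothesis hP : prob_assignment P.

Let mu_prefix s : mu (prefix s) = (P (cyl s))%:E.
Proof.
have [l0 l1] := left_end_bound hP s.
rewrite -[mu _]/(lebesgue_measure (prefix s `&` `[0, 1[)).
rewrite (_ : prefix s `&` _ = `[left_end P s, left_end P s + P (cyl s)[%classic).
  rewrite lebesgue_measure_itv /= lte_fin -EFinD addrAC subrr add0r.
  (* The length formula returns 0 unless the left end is strictly below the right one; that case
     forces [P (cyl s)] to be 0. *)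
  by case: ltP (pa_ge0 hP (cyl s)) => //; rewrite gerDl => ? ?; congr EFin; lra.
apply/seteqP; split=> x /=; rewrite !in_itv /= /prefix /=.
  by move=> [/eqP]; move=> + x01; rewrite digits_itv.
move=> xs; have x01 : 0 <= x < 1 by lra.
by split=> //; apply/eqP; rewrite digits_itv.
Qed.

(** Induction on [n], the number of further digits that suffice to decide [a], with [s] general
    because it grows as [n] decreases. *)
Let mu_prefix_eval n s a :
  (forall v w, (forall j, (j < n + size s)%N -> v j = w j) ->
    eval v a = eval w a) ->
  mu (prefix s `&` [set x | eval (bit P ^~ x) a]) = (P (And (cyl s) a))%:E.
Proof.
elim: n s => [|n IH] s an.
  have ws v w : eval v (cyl s) -> eval w (cyl s) -> eval v a = eval w a.
    by move=> vs ws; apply: an => j; exact: eval_cyl_inj.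
  have cx x : prefix s x -> eval (bit P ^~ x) (cyl s).
    by rewrite /prefix /= => <-; exact: eval_cyl_digits.
  (* All valuations in the cylinder agree on [a]: if one satisfies it, both sides are the mass of
     the cylinder; otherwise both are 0. *)
  have [[w /andP[w1 w2]]|nw] :=
    pselect (exists w, eval w (cyl s) && eval w a).
    rewrite (@pa_eq _ _ hP (And (cyl s) a) (cyl s)).
      rewrite -mu_prefix; congr (mu _).
      by apply/setIidPl => x /cx xs /=; rewrite (ws _ w).
    move=> v; rewrite eval_And; case vs: (eval v (cyl s)) => //.
    by rewrite (ws _ w).
  rewrite pa_unsat //.
    rewrite (_ : _ `&` _ = set0) ?measure0 //.
    apply/seteqP; split=> x //= [/cx xs xa]; apply: nw.
    by exists (bit P ^~ x); rewrite xs.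
  by move=> v; apply/negP; rewrite eval_And => va; apply: nw; exists v.
(* Split on the first symbol that [s] leaves undetermined, and apply the induction hypothesis to
   both extensions of [s]. *)
rewrite (pa_split hP _ (Var (size s))).
have E (b : bool) : (P (And (cyl (b :: s)) a))%:E =
    mu (prefix (b :: s) `&` [set x | eval (bit P ^~ x) a]).
  by rewrite IH // => v w vw; apply: an => j; rewrite addSnnS; exact: vw.
rewrite (@pa_eq _ _ hP _ (And (cyl (false :: s)) a)); last first.
  by move=> v; rewrite [cyl _]/= !eval_And andbAC.
rewrite (@pa_eq _ _ hP (And (And _ _) _) (And (cyl (true :: s)) a)); last first.
  by move=> v; rewrite [cyl _]/= !eval_And andbAC.
rewrite EFinD !E -measureU.
- congr (mu _); rewrite -setIUl; congr (_ `&` _).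
  rewrite !prefix_cons -setIUr; apply/esym/setIidPl => x _ /=.
  by case: (_ <= _); [right|left].
- by apply: measurableI => //; exact: measurable_eval_bit.
- by apply: measurableI => //; exact: measurable_eval_bit.
- apply/seteqP; split=> x //=; rewrite !prefix_cons.
  by move=> [[[_ /= ->] _] [[_]]].
Qed.

Lemma unit_lebesgue_eval_bit a :
  unit_lebesgue [set x | eval (bit P ^~ x) a] = (P a)%:E.
Proof.
have [n an] := eval_finitely_determined a.
(* The empty prefix imposes no condition, and its cylinder is [Top]. *)
have := @mu_prefix_eval n [::] a; rewrite addn0 => /(_ an).
rewrite (_ : prefix [::] = setT) ?setTI; last by apply/seteqP; split.
by move=> ->; rewrite (@pa_eq _ _ hP _ a) // => v; rewrite eval_And /= implybb.
Qed.

End bit_law.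

(** * The stochastic valuation and its uniqueness *)

HB.instance Definition _ (R : realType) (P : pform -> R) (j : nat) :=
  isMeasurableFun.Build _ _ _ _ (@bit R P j) (@measurable_bit R P j).

Definition bit_valuation (R : realType) (P : pform -> R) : stoch_valuation R :=
  @StochValuation R _ _ (@unit_lebesgue R) (@bit R P).

Theorem proposition2p8 (R : realType) (P : pform -> R)
    (hP : prob_assignment P) :
  exists V : stoch_valuation R,
    (forall A U : {fset nat}, A != fset0 -> (U `<=` A)%fset ->
       Prob V A U = (P (phi A U))%:E) /\
    (forall W : stoch_valuation R,
       (forall A U : {fset nat}, A != fset0 -> (U `<=` A)%fset ->
          Prob W A U = (P (phi A U))%:E) ->
       same_fdd W V).
Proof.
have VP (A U : {fset nat}) : A != fset0 -> (U `<=` A)%fset ->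
    Prob (bit_valuation P) A U = (P (phi A U))%:E.
  (* The digits agree with [U] on [A] exactly when they satisfy [phi A U]. *)
  move=> _ UA; rewrite /Prob -(unit_lebesgue_eval_bit hP); congr unit_lebesgue.
  apply/seteqP; split=> x /=; first by move=> xA; apply/eval_phi.
  by move/(eval_phi _ UA).
exists (bit_valuation P); split=> // W WP A U A0 UA.
(* Both distributions are prescribed by [P], hence equal. *)
by rewrite WP ?VP.
Qed.
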